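(* Let $f:X\to Y$ be a continuous map between locally compact Hausdorff spaces, let $(A,\rho,\mathbb{B})=(RC(X),\rho_X,CR(X))$, $(B,\eta,\mathbb{B}')=(RC(Y),\rho_Y,CR(Y))$, and let $\varphi=\Lambda^t(f):B\to A$ be given by $\varphi(G)=\mathrm{cl}(f^{-1}(\mathrm{int}(G)))$. Then $f$ is a dense embedding iff $\varphi$ is a Boolean isomorphism satisfying the following condition: (LO') for all $b\in B$ and all $a\in\mathbb{B}$, $\varphi^{-1}(a)\,\eta\, b$ implies $a\,\rho\,\varphi(b)$.
   Context: For a space $X$, $RC(X)$ is the complete Boolean algebra of regular closed subsets of $X$ (those $F$ with $F=\mathrm{cl}(\mathrm{int}(F))$), ordered by inclusion, with $F\vee G=F\cup G$, $F\wedge G=\mathrm{cl}(\mathrm{int}(F\cap G))$, $F^*=\mathrm{cl}(X\setminus F)$; $CR(X)$ is the ideal of compact regular closed subsets; and $F\,\rho_X\,G$ iff $F\cap G\neq\emptyset$. A dense embedding is a homeomorphic embedding $f:X\to Y$ with $f(X)$ dense in $Y$. *)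

(* Defs.v *)
From HB Require Import structures.
From mathcomp Require Import all_boot all_order.
From mathcomp Require Import all_classical topology.

Set Implicit Arguments.
Unset Strict Implicit.
Unset Printing Implicit Defensive.

Import Order.TTheory.
Local Open Scope classical_set_scope.

Definition homeomorphism (X Y : topologicalType) (f : X -> Y) : Prop :=
  exists g : Y -> X,
    [/\ cancel f g, cancel g f, continuous f & continuous g].

(* [range f], seen as a type, carries the subspace topology of [Y]. *)
Definition corestriction (X Y : Type) (f : X -> Y) (x : X) : range f :=
  SigSub (mem_set (imageT f x)).

Definition homeomorphic_embedding (X Y : topologicalType) (f : X -> Y) : Prop :=
  homeomorphism (corestriction f).

Definition dense_embedding (X Y : topologicalType) (f : X -> Y) : Prop :=
  homeomorphic_embedding f /\ dense (range f).

Record RC (X : topologicalType) : Type := MkRC {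
  rcset :> set X;
  rcset_asbool : `[< regclosed rcset >] }.

HB.instance Definition _ (X : topologicalType) := [isSub for @rcset X].
HB.instance Definition _ (X : topologicalType) := [Choice of RC X by <:].

Lemma rcP (X : topologicalType) (F : RC X) : regclosed F.
Proof. by case: F => F /= /asboolP. Qed.

Definition mkRC (X : topologicalType) (F : set X) (rF : regclosed F) : RC X :=
  MkRC (asboolT rF).

Lemma rc_inj (X : topologicalType) (F G : RC X) : rcset F = rcset G -> F = G.
Proof. exact: val_inj. Qed.

Fact rc_display : Order.disp_t. Proof. exact: Order.Disp tt tt. Qed.

(* The order is that of [set X], i.e. inclusion; see [le_rcE]. *)
HB.instance Definition _ (X : topologicalType) :=
  Order.SubChoice_isSubPOrder.Build set_display (set X)
    (fun F => `[< regclosed F >]) rc_display (RC X).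

Lemma le_rcE (X : topologicalType) (F G : RC X) :
  (F <= G)%O = `[< (F : set X) `<=` G >].
Proof. by []. Qed.

Section RC_Boolean_algebra.
Variable X : topologicalType.
Implicit Types F G H : RC X.

Lemma rc_closed F : closed F.
Proof. by rewrite -(rcP F); exact: closed_closure. Qed.

Lemma closure_interior_sub (A : set X) : closed A -> closure A° `<=` A.
Proof.
move=> cA; rewrite [X in _ `<=` X](iffLR (closure_id _) cA).
by apply: closureS; exact: interior_subset.
Qed.

Lemma closure_subl (A B : set X) : A `<=` closure B -> closure A `<=` closure B.
Proof.
move=> AB; rewrite [X in _ `<=` X](iffLR (closure_id _)).
  exact: closureS.
exact: closed_closure.
Qed.

Fact rc_join_subproof F G : regclosed (F `|` G).
Proof.
apply/seteqP; split.
  by apply: closure_interior_sub; apply: closedU; exact: rc_closed.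
by rewrite -{1}(rcP F) -{1}(rcP G) -closureU; apply/closureS/interiorU.
Qed.

Definition rc_join F G : RC X := mkRC (rc_join_subproof F G).

Definition rc_meet F G : RC X :=
  mkRC (closure_open_regclosed (open_interior (F `&` G))).

Fact rc_compl_subproof F : regclosed (closure (~` F)).
Proof. by apply: closure_open_regclosed; apply/closed_openC/rc_closed. Qed.

Definition rc_compl F : RC X := mkRC (rc_compl_subproof F).

Fact rc_bot_subproof : regclosed (set0 : set X).
Proof. by rewrite /regclosed interior0 closure0. Qed.

Definition rc_bot : RC X := mkRC rc_bot_subproof.

Fact rc_top_subproof : regclosed (setT : set X).
Proof. by rewrite /regclosed interiorT closureT. Qed.

Definition rc_top : RC X := mkRC rc_top_subproof.

Fact rc_meetP F G H : (F <= rc_meet G H)%O = (F <= G)%O && (F <= H)%O.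
Proof.
rewrite !le_rcE /=; apply/asboolP/andP => [FGH|[/asboolP FG /asboolP FH]].
  have GHs : closure (G `&` H)° `<=` G `&` H.
    by apply: closure_interior_sub; apply: closedI; exact: rc_closed.
  by split; apply/asboolP => x /FGH/GHs[].
rewrite -{1}(rcP F); apply/closureS/interiorS => x Fx.
by split; [exact: FG|exact: FH].
Qed.

Fact rc_joinP F G H : (rc_join F G <= H)%O = (F <= H)%O && (G <= H)%O.
Proof.
rewrite !le_rcE /=; apply/asboolP/andP => [FGH|[/asboolP FH /asboolP GH]].
  by split; apply/asboolP => x ?; apply: FGH; [left|right].
by rewrite subUset.
Qed.

HB.instance Definition _ := Order.POrder_MeetJoin_isLattice.Build rc_display
  (RC X) rc_meetP rc_joinP.

Fact rc_meetUl :
  @left_distributive (RC X) (RC X) (@Order.meet _ _) (@Order.join _ _).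
Proof.
move=> F G H; apply/le_anti/andP; split; last first.
  by rewrite leUx !lexI !leIr !(le_trans (leIl _ _)) ?leUl ?leUr.
rewrite le_rcE; apply/asboolP => /=.
rewrite -closureU; apply: closure_subl => y Uy W Wy.
have {Wy} WUy : nbhs y (W `&` ((F `|` G) `&` H)°).
  by apply: filterI => //; exact: nbhs_interior.
have /interior_subset[FGy _] := Uy.
case: FGy => Ky; move: (Ky); rewrite -[X in X y]rcP => /(_ _ WUy)
    [z [Kz [Wz Uz]]]; exists z; split=> //; [left|right];
  by move: Uz; rewrite !interiorI => -[_ Hz].
Qed.

HB.instance Definition _ :=
  Order.Lattice_Meet_isDistrLattice.Build rc_display (RC X) rc_meetUl.

Fact rc_le0x F : (rc_bot <= F)%O.
Proof. by rewrite le_rcE; apply/asboolP; exact: sub0set. Qed.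

Fact rc_lex1 F : (F <= rc_top)%O.
Proof. by rewrite le_rcE; apply/asboolP; exact: subsetT. Qed.

HB.instance Definition _ := Order.hasBottom.Build rc_display (RC X) rc_le0x.
HB.instance Definition _ := Order.hasTop.Build rc_display (RC X) rc_lex1.

Fact rc_joinxC F : (F `|` rc_compl F = \top)%O.
Proof.
apply: rc_inj; apply/seteqP; split=> //= y _.
by have [Fy|nFy] := pselect (rcset F y); [left|right; exact: subset_closure].
Qed.

Fact rc_meetxC F : (F `&` rc_compl F = \bot)%O.
Proof.
apply: rc_inj => /=; rewrite closure_setC interiorI interiorC (rcP F).
by rewrite (_ : _ `&` _ = set0) ?closure0// -subset0 => y [/interior_subset].
Qed.

HB.instance Definition _ := Order.TBDistrLattice_hasComplement.Build
  rc_display (RC X) rc_joinxC rc_meetxC.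

Lemma rc_joinE F G : rcset (F `|` G)%O = rcset F `|` rcset G.
Proof. by []. Qed.

Lemma rc_meetE F G : rcset (F `&` G)%O = closure (rcset F `&` rcset G)°.
Proof. by []. Qed.

Lemma rc_complE F : rcset (~` F)%O = closure (~` rcset F).
Proof. by []. Qed.

Lemma rc_botE : rcset (\bot%O : RC X) = set0.
Proof. by []. Qed.

Lemma rc_topE : rcset (\top%O : RC X) = setT.
Proof. by []. Qed.

Definition CR : set (RC X) := [set F | compact (F : set X)].

Definition rho F G : Prop := (F : set X) `&` G !=set0.

End RC_Boolean_algebra.

Definition Boolean_morphism (dA dB : Order.disp_t) (A : ctbDistrLatticeType dA)
    (B : ctbDistrLatticeType dB) (h : A -> B) : Prop :=
  [/\ Order.meet_morphism h, Order.join_morphism h,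
      h \bot%O = \bot%O, h \top%O = \top%O & {morph h : x / (~` x)%O}].

(* [k] is the (unique) inverse of the isomorphism [h]. *)
Definition Boolean_isomorphism (dA dB : Order.disp_t)
    (A : ctbDistrLatticeType dA) (B : ctbDistrLatticeType dB)
    (h : A -> B) (k : B -> A) : Prop :=
  [/\ Boolean_morphism h, cancel h k & cancel k h].

Section Lambda_t.
Variables (X Y : topologicalType) (f : X -> Y) (cf : continuous f).

Fact Lambda_t_subproof (G : RC Y) :
  regclosed (closure (f @^-1` (G : set Y)°)).
Proof.
apply: closure_open_regclosed; apply: open_comp; last exact: open_interior.
by move=> x _; exact: cf.
Qed.

Definition Lambda_t (G : RC Y) : RC X := mkRC (Lambda_t_subproof G).

End Lambda_t.

(* [phi_inv] is meant to be the inverse of the bijection [phi]. *)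
Definition LO' (X Y : topologicalType) (phi : RC Y -> RC X)
    (phi_inv : RC X -> RC Y) : Prop :=
  forall (b : RC Y) (a : RC X), CR a -> rho (phi_inv a) b -> rho a (phi b).

(* Main.v *)
Require Import Defs.
From mathcomp Require Import all_boot all_order.
From mathcomp Require Import all_classical topology.

(** If [f] is a dense embedding, identify [X] with a dense subspace of [Y].
    Every regular closed [F] of [X] is then the trace of its closure in [Y],
    and every regular closed [G] of [Y] is the closure of the trace of its
    interior, because an open set and its trace on a dense subspace have the
    same closure. So [F |-> closure (f @` F)] and [Lambda_t] are mutually
    inverse monotone maps ([Lambda_t_closure_image], [closure_image_Lambda_t]),
    and an order isomorphism of Boolean algebras is a Boolean isomorphism.
    For compact [F], the image [f @` F] is already closed, so a point where
    its closure meets [b] is some [f x] with [x] in [F]; density puts [x] in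
    [Lambda_t b], which is (LO') ([embedding_LO']).

    Conversely, if [Lambda_t] is injective, no nonempty regular closed set has
    its interior disjoint from the range, and the interiors of regular closed
    sets form a base of the regular space [Y], so the range is dense
    ([Lambda_t_inj_dense]). It remains to show that [f] induces the topology
    of [X] ([LO'_initial_nbhs]). Given a neighbourhood of [x], shrink it to
    regular closed neighbourhoods [a'] and [a] of [x], with [a'] compact and
    contained in the interior of [a]. Then [a'] misses the complement of [a]
    in [RC X], so by (LO') the element of [RC Y] corresponding to [a'] misses
    the complement of the one, [c], corresponding to [a]. As [f x] lies in the
    former, it is interior to [c], and the preimage of the interior of [c] is
    contained in [a]. *)

Set Implicit Arguments.
Unset Strict Implicit.
Unset Printing Implicit Defensive.

Import Order.Theory.
Local Open Scope classical_set_scope.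

(** * Order isomorphisms and embeddings *)

(** Meets, joins, bounds and complements are determined by the order. *)
Lemma order_isomorphism_Boolean (dA dB : Order.disp_t)
    (A : ctbDistrLatticeType dA) (B : ctbDistrLatticeType dB)
    (h : A -> B) (k : B -> A) :
  {homo h : x y / (x <= y)%O} -> {homo k : x y / (x <= y)%O} ->
  cancel h k -> cancel k h -> Boolean_isomorphism h k.
Proof.
move=> hh hk hK kK.
have le_hk x y : (h x <= y)%O = (x <= k y)%O.
  by apply/idP/idP => [/hk|/hh]; rewrite ?hK ?kK.
have le_kh x y : (y <= h x)%O = (k y <= x)%O.
  by apply/idP/idP => [/hk|/hh]; rewrite ?hK ?kK.
have hI : Order.meet_morphism h.
  by move=> x y; apply/eqP/eq_geP => z; rewrite !(lexI, le_kh).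
have hU : Order.join_morphism h.
  by move=> x y; apply/eqP/eq_leP => z; rewrite !(leUx, le_hk).
have h0 : h \bot%O = \bot%O by apply/eqP; rewrite -lex0 le_hk le0x.
have h1 : h \top%O = \top%O by apply/eqP; rewrite -le1x le_kh lex1.
split=> //; split=> // x; apply/le_anti.
rewrite -disj_leC -hI meetC meetxC h0 eqxx/=.
by rewrite -[leRHS]complK -disj_leC -complU -hU joinxC h1 compl1.
Qed.

(** The nontrivial half of being initial: [f] detects the neighbourhoods of
    its source. For continuous [f] with Hausdorff source this is equivalent to
    being an embedding, see [initial_nbhs_embedding]. *)
Definition initial_nbhs (X Y : topologicalType) (f : X -> Y) : Prop :=
  forall x U, nbhs x U -> exists V, [/\ open V, V (f x) & f @^-1` V `<=` U].

Lemma embedding_initial_nbhs (X Y : topologicalType) (f : X -> Y) :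
  homeomorphic_embedding f -> initial_nbhs f.
Proof.
move=> [g [fgK _ _ cg]] x U xU.
have : nbhs (corestriction f x) (g @^-1` U) by apply: cg; rewrite fgK.
rewrite nbhsE => -[W [[V oV <-] Vfx] WU]; exists V; split => // z Vfz.
by have /= := WU (corestriction f z) Vfz; rewrite fgK.
Qed.

(** Injectivity comes for free: two points with the same image would have the
    same neighbourhoods. *)
Lemma initial_nbhs_embedding (X Y : topologicalType) (f : X -> Y) :
  hausdorff_space X -> continuous f -> initial_nbhs f ->
  homeomorphic_embedding f.
Proof.
move=> hX cf fnbhs.
have finj : injective f.
  move=> x y fxy; apply: hX => U W xU yW.
  have [V [oV Vfx VU]] := fnbhs x U xU.
  exists y; split; last exact: nbhs_singleton.
  by apply: VU => /=; rewrite -fxy.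
have preim (y : range f) : {x | f x = val y}.
  by apply: cid; have [x _ fx] := set_valP y; exists x.
pose g y := sval (preim y).
have fg y : f (g y) = val y by rewrite /g; case: (preim y).
exists g; split.
- by move=> x; apply: finj; rewrite fg.
- by move=> y; apply: val_inj; rewrite /= fg.
- by apply/continuousP => _ [V oV <-]; move/continuousP: cf; exact.
- move=> y U /= /fnbhs[V [oV Vgy VU]].
  rewrite /= nbhsE; exists (set_val @^-1` V).
    by split; [exists V|move: Vgy; rewrite fg].
  by move=> z Vz; apply: VU; rewrite /= fg.
Qed.

Lemma closure_denseI (Y : topologicalType) (D V : set Y) :
  dense D -> open V -> closure (V `&` D) = closure V.
Proof.
move=> dD oV; apply/seteqP; split; first by apply/closureS; exact: subIsetl.
apply: closure_subl => y Vy W; rewrite nbhsE => -[O [oO Oy] OW].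
have [z [[Vz Oz] Dz]] : (V `&` O) `&` D !=set0.
  by apply: dD; [exists y|exact: openI].
by exists z; split=> //; exact: OW.
Qed.

Lemma image_closure_sub (X Y : topologicalType) (f : X -> Y) (A : set X) :
  continuous f -> f @` closure A `<=` closure (f @` A).
Proof.
move=> cf _ [x clAx <-] W /cf/clAx[z [Az Wz]].
by exists (f z); split=> //; exists z.
Qed.

Lemma closure_image_closure (X Y : topologicalType) (f : X -> Y) (A : set X) :
  continuous f -> closure (f @` closure A) = closure (f @` A).
Proof.
move=> cf; apply/seteqP; split.
  by apply: closure_subl; exact: image_closure_sub.
by apply/closureS/image_subset; exact: subset_closure.
Qed.

(** Compact Hausdorff neighbourhoods make the space regular at [x]; the
    closure of the interior of a small closed neighbourhood is then regular
    closed, and compact once it lies in a compact set. *)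
Lemma CR_nbhs_base (X : topologicalType) : locally_compact [set: X] ->
  hausdorff_space X -> forall (x : X) U, nbhs x U ->
  exists F : RC X, [/\ CR F, nbhs x (F : set X) & (F : set X) `<=` U].
Proof.
move=> lcX hX x U xU; have [K] := lcX x I.
rewrite withinET => xK [cK clK].
have [W xW WKU] := compact_regular hX cK xK (filterI xU xK).
have sub : closure W° `<=` U `&` K.
  by apply: subset_trans WKU; apply: closureS; exact: interior_subset.
exists (mkRC (closure_open_regclosed (@open_interior _ W))); split.
- apply: (subclosed_compact _ cK) => /=; first exact: closed_closure.
  by move=> z /sub[].
- by apply: filterS (nbhs_interior xW) => /=; exact: subset_closure.
- by move=> z /sub[].
Qed.

(** * Dense embeddings induce isomorphisms satisfying (LO') *)

Section dense_embedding.
Variables (X Y : topologicalType) (f : X -> Y).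
Hypotheses (cf : continuous f) (femb : initial_nbhs f).
Hypothesis fdense : dense (range f).

Lemma open_preimage_initial (U : set X) : open U ->
  exists2 V, open V & U = f @^-1` V.
Proof.
move=> oU; exists (\bigcup_(V in [set V | open V /\ f @^-1` V `<=` U]) V).
  by apply: bigcup_open => V [].
apply/seteqP; split=> [x Ux|x [V [_ VU]]]; last exact: VU.
have [V [oV Vfx VU]] := femb (open_nbhs_nbhs (conj oU Ux)).
by exists V.
Qed.

Lemma closure_image_preimage (V : set Y) : open V ->
  closure (f @` (f @^-1` V)) = closure V.
Proof.
move=> oV; rewrite -(closure_denseI fdense oV); congr closure.
apply/seteqP; split=> [_ [x Vfx <-]|y [Vy [x _ fxy]]].
  by split=> //; exists x.
by exists x; rewrite //= fxy.
Qed.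

(** The interior of [F] is the trace of an open set, with the same closure
    in [Y] by density; so the closure of the image of [F] is the closure of an
    open set. *)
Fact closure_image_regclosed (F : RC X) : regclosed (closure (f @` F)).
Proof.
have [V oV FV] := open_preimage_initial (open_interior (F : set X)).
rewrite -(rcP F) FV !closure_image_closure// closure_image_preimage//.
exact: closure_open_regclosed.
Qed.

Definition closure_image (F : RC X) : RC Y := mkRC (closure_image_regclosed F).

Lemma closure_image_Lambda_t : cancel (Lambda_t cf) closure_image.
Proof.
move=> G; apply: rc_inj => /=.
rewrite closure_image_closure// closure_image_preimage ?rcP//.
exact: open_interior.
Qed.

Lemma preimage_closure_image (A : set X) :
  f @^-1` closure (f @` A) `<=` closure A.
Proof.
move=> x clx W /femb[V [oV Vfx VW]].
have [_ [[z Az <-] Vfz]] := clx _ (open_nbhs_nbhs (conj oV Vfx)).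
by exists z; split=> //; exact: VW.
Qed.

Lemma Lambda_t_closure_image : cancel closure_image (Lambda_t cf).
Proof.
move=> F; apply: rc_inj => /=; apply/seteqP; split.
  rewrite [X in _ `<=` X](iffLR (closure_id _) (@rc_closed _ F)).
  apply/closure_subl => x /interior_subset/preimage_closure_image.
  exact.
(* By density, [V] lies in the closure of the image of [F]. *)
have [V oV FV] := open_preimage_initial (open_interior (F : set X)).
rewrite -[X in X `<=` _]rcP; apply: closureS; rewrite {1}FV => x Vfx.
rewrite -[X in closure (f @` X)]rcP closure_image_closure// FV.
rewrite closure_image_preimage//=.
by apply: (interiorS (@subset_closure _ V)); rewrite (iffLR (interior_id _)).
Qed.

Lemma dense_embedding_Boolean_isomorphism :
  Boolean_isomorphism (Lambda_t cf) closure_image.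
Proof.
apply: order_isomorphism_Boolean; last 2 first.
- exact: closure_image_Lambda_t.
- exact: Lambda_t_closure_image.
- move=> G H; rewrite !le_rcE => /asboolP GH; apply/asboolP => /=.
  by apply: closureS; apply: preimage_subset; exact: interiorS.
- move=> F G; rewrite !le_rcE => /asboolP FG; apply/asboolP => /=.
  by apply: closureS; exact: image_subset.
Qed.

(** Compactness of [a] makes its image closed, so that the points of
    [closure_image a] lie in the range of [f]. *)
Lemma embedding_LO' : hausdorff_space Y -> LO' (Lambda_t cf) closure_image.
Proof.
move=> hY b a ca [y []] /=.
have clfa : closed (f @` a).
  apply: compact_closed => //; apply: continuous_compact => //.
  exact: continuous_subspaceT.
rewrite -(iffLR (closure_id _) clfa) => -[x ax <-] bfx.
exists x; split=> // W /femb[V [oV Vfx VW]].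
move: bfx; rewrite -[X in X _]rcP => /(_ V (open_nbhs_nbhs (conj oV Vfx))).
move=> [z bVz].
have [w [[bw Vw] [t _ tw]]] : ((b : set Y)° `&` V) `&` range f !=set0.
  by apply: fdense; [exists z|apply: openI => //; exact: open_interior].
by exists t; split; [|apply: VW]; rewrite /= tw.
Qed.

End dense_embedding.

(** * Isomorphisms satisfying (LO') come from dense embeddings *)

Section from_isomorphism.
Variables (X Y : topologicalType) (f : X -> Y) (cf : continuous f).

(** A nonempty regular closed set avoiding the range would be sent to [set0],
    like the bottom element. *)
Lemma Lambda_t_inj_dense : locally_compact [set: Y] -> hausdorff_space Y ->
  injective (Lambda_t cf) -> dense (range f).
Proof.
move=> lcY hY inj O [y Oy] oO; apply: contrapT => Of.
have [G [_ yG GO]] := CR_nbhs_base lcY hY (open_nbhs_nbhs (conj oO Oy)).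
have fG (H : RC Y) : (H : set Y) `<=` O -> rcset (Lambda_t cf H) = set0.
  move=> HO; rewrite /= -[RHS]closure0; congr closure; rewrite -subset0.
  by move=> x /interior_subset/HO Ofx; apply: Of; exists (f x); split.
have G0 : G = \bot%O by apply/inj/rc_inj; rewrite !fG.
by have := nbhs_singleton yG; rewrite G0.
Qed.

Lemma image_Lambda_t (G : RC Y) : f @` (Lambda_t cf G) `<=` G.
Proof.
rewrite -[X in _ `<=` X]rcP => y /(image_closure_sub cf).
by apply: closureS => _ [x Gx <-].
Qed.

(** Here (LO') is used contrapositively: from [a'] disjoint from [Lambda_t b]
    to the element corresponding to [a'] disjoint from [b]. *)
Lemma LO'_initial_nbhs (psi : RC X -> RC Y) :
  locally_compact [set: X] -> hausdorff_space X ->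
  {morph Lambda_t cf : G / (~` G)%O} -> cancel psi (Lambda_t cf) ->
  LO' (Lambda_t cf) psi -> initial_nbhs f.
Proof.
move=> lcX hX phiC psiK lo x U xU.
have [a [_ xa aU]] := CR_nbhs_base lcX hX xU.
have [a' [ca' xa' a'a]] := CR_nbhs_base lcX hX (nbhs_interior xa).
exists (psi a : set Y)°; split; first exact: open_interior.
  have psi_a'x : (psi a' : set Y) (f x).
    apply: image_Lambda_t; rewrite psiK.
    by exists x => //; exact: nbhs_singleton.
  apply: contrapT => nax.
  have [z [a'z]] : rho a' (Lambda_t cf (~` psi a)%O).
    by apply: lo => //; exists (f x); split; rewrite // rc_complE closure_setC.
  by rewrite phiC psiK rc_complE closure_setC; apply; exact: a'a.
apply: subset_trans aU; rewrite -[X in _ `<=` rcset X](psiK a).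
exact: subset_closure.
Qed.

End from_isomorphism.

Theorem theorem3p25 (X Y : topologicalType)
    (lcX : locally_compact [set: X]) (hX : hausdorff_space X)
    (lcY : locally_compact [set: Y]) (hY : hausdorff_space Y)
    (f : X -> Y) (cf : continuous f) :
  dense_embedding f <->
  exists phi_inv : RC X -> RC Y,
    Boolean_isomorphism (Lambda_t cf) phi_inv /\ LO' (Lambda_t cf) phi_inv.
Proof.
split=> [[/embedding_initial_nbhs femb fd]|].
  exists (closure_image cf femb fd); split.
    exact: dense_embedding_Boolean_isomorphism.
  exact: embedding_LO'.
move=> [psi [[[_ _ _ _ phiC] phiK psiK] lo]]; split.
  apply: initial_nbhs_embedding => //.
  exact: LO'_initial_nbhs lo.
apply: (@Lambda_t_inj_dense _ _ _ cf) => //; exact: can_inj phiK.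
Qed.
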